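(* Let $\tau\in\mathcal{T}_{t,T}$. Then there exist a sequence $(N_n)_n\subset\mathbb{N}$ and a sequence of stopping times $(\tau_n)_n\subset\mathcal{T}_{t,T}$ converging to $\tau$ almost surely and such that, for every $n$, \[ \tau_n=\sum_{i=1}^{N_n}\tau_{n,i}\,\mathbf{1}_{G_{n,i}}, \] where $\tau_{n,i}\in\tilde{\mathcal{T}}_{t,T}$ for all $i=1,\dots,N_n$ and $\{G_{n,1},\dots,G_{n,N_n}\}\subset\mathcal{G}$ is a partition of $\Omega$.
   Context: Let $(\Omega,\mathcal{F},\mathbb{P})$ be a complete probability space, $T>0$ and $t\in[0,T]$. Let $\mathbb{H}=(\mathcal{H}_s)_{s\in[t,T]}$ be a filtration and $\mathcal{G}$ a $\sigma$-algebra (all sub-$\sigma$-algebras of $\mathcal{F}$), with $\mathcal{G}$ and $\mathcal{H}_T$ independent. Let $\mathbb{F}=(\mathcal{F}_s)_{s\in[t,T]}$ be the filtration $\mathcal{F}_s=\mathcal{G}\vee\mathcal{H}_s$, $s\in[t,T]$. $\mathcal{T}_{t,T}$ and $\tilde{\mathcal{T}}_{t,T}$ denote the sets of all $[t,T]$-valued stopping times with respect to $\mathbb{F}$ and $\mathbb{H}$, respectively. *)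

(* Defs.v *)
From HB Require Import structures.
From mathcomp Require Import all_boot all_order all_algebra.
From mathcomp Require Import all_classical all_reals all_analysis.

Set Implicit Arguments.
Unset Strict Implicit.
Unset Printing Implicit Defensive.

Import Order.TTheory GRing.Theory Num.Theory.
Import numFieldNormedType.Exports.

Local Open Scope classical_set_scope.
Local Open Scope ring_scope.

Definition sub_sigma_field (d : measure_display) (Omega : measurableType d)
    (G : set (set Omega)) : Prop :=
  sigma_algebra setT G /\ G `<=` measurable.

(* The time index set is [t, T]: a family indexed by the whole of R is used,
   but its values outside [t, T] are never constrained nor consulted. *)
Definition filtration (d : measure_display) (Omega : measurableType d)
    (R : realType) (t T : R) (H : R -> set (set Omega)) : Prop :=
  (forall s, t <= s <= T -> sub_sigma_field (H s)) /\
  (forall s u, t <= s -> s <= u -> u <= T -> H s `<=` H u).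

Definition stopping_time (Omega : Type) (R : realType) (t T : R)
    (H : R -> set (set Omega)) (tau : Omega -> R) : Prop :=
  (forall w, t <= tau w <= T) /\
  (forall s, t <= s <= T -> H s [set w | tau w <= s]).

Definition independent_sigma_fields (d : measure_display)
    (Omega : measurableType d) (R : realType) (P : probability Omega R)
    (G K : set (set Omega)) : Prop :=
  forall A B, G A -> K B -> P (A `&` B) = (P A * P B)%E.

Definition sigma_join (Omega : Type) (G K : set (set Omega)) :
    set (set Omega) := <<s G `|` K >>.

(* Main.v *)
(** On a grid [t = s_0 <= ... <= s_m = T], each event [{tau <= s_j}] lies in the
    join of [G] and [H (s_j)], hence agrees, off an event of small probability,
    with a finite union of rectangles [A_i `&` k_j i], where the [A_i] form a
    [G]-measurable partition, common to all [j] after refinement, and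
    [k_j i] is in [H (s_j)].  On [A_i], replace [tau] by the first grid time
    [s_j] with [w] in [k_j i], which is an [H]-stopping time; off the small event
    this differs from [tau] by at most the mesh.  Borel-Cantelli gives almost
    sure convergence. *)

Require Import Defs.
From HB Require Import structures.
From mathcomp Require Import all_boot all_order all_algebra.
From mathcomp Require Import all_classical all_reals all_analysis.

Set Implicit Arguments.
Unset Strict Implicit.
Unset Printing Implicit Defensive.

Import Order.TTheory GRing.Theory Num.Theory.
Import numFieldNormedType.Exports.

Local Open Scope classical_set_scope.
Local Open Scope ring_scope.

(** A finite [G]-measurable partition is encoded by a labelling map whose fibres are the cells.
    Empty fibres are allowed, and the common refinement of two partitions is the pairing of their
    labels. *)
Definition finite_selector (T : Type) (G : set (set T)) (I : finType)
    (g : T -> I) :=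
  forall i, G (g @^-1` [set i]).

(** * Finite unions of rectangles over a finite [G]-measurable partition *)

Section piecewise_sets.
Context (T : pointedType).
Implicit Types (G K : set (set T)) (B C : set T).

(* [C] is the finite union of the rectangles [g @^-1` [set i] `&` k i]. *)
Definition piecewise G K C :=
  exists (I : finType) (g : T -> I) (k : I -> set T),
    [/\ finite_selector G g, forall i, K (k i) & C = [set w | k (g w) w]].

Lemma finite_selector_pair G (I J : finType) (g : T -> I) (h : T -> J) :
  sigma_algebra setT G -> finite_selector G g -> finite_selector G h ->
  finite_selector G (fun w => (g w, h w)).
Proof.
move=> sG gG hG [i j].
have -> : (fun w => (g w, h w)) @^-1` [set (i, j)] =
          (g @^-1` [set i]) `&` (h @^-1` [set j]).
  by apply/seteqP; split=> w /= [-> ->].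
move: (gG i) (hG j); rewrite -(measurable_g_measurableTypeE sG).
exact: measurableI.
Qed.

Lemma piecewise_left G K C : sigma_algebra setT G -> sigma_algebra setT K ->
  G C -> piecewise G K C.
Proof.
move=> sG sK; rewrite -(measurable_g_measurableTypeE sG).
rewrite -(measurable_g_measurableTypeE sK) => GC.
exists bool, (fun w => `[< C w >]), (fun b => if b then setT else set0).
split=> [[]|[]|].
- suff -> : (fun w => `[< C w >]) @^-1` [set true] = C by [].
  by apply/seteqP; split=> w /= /asboolP.
- suff -> : (fun w => `[< C w >]) @^-1` [set false] = ~` C by exact: measurableC.
  by apply/seteqP; split=> w /=; case: asboolP.
- exact: measurableT.
- exact: measurable0.
- by apply/seteqP; split=> w /=; case: asboolP.
Qed.

Lemma piecewise_right G K C : sigma_algebra setT G -> K C -> piecewise G K C.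
Proof.
move=> sG KC; exists unit, (fun=> tt), (fun=> C); split=> // -[].
rewrite -(measurable_g_measurableTypeE sG) (_ : _ @^-1` _ = setT) //.
by apply/seteqP; split.
Qed.

Lemma piecewiseC G K C : sigma_algebra setT K ->
  piecewise G K C -> piecewise G K (~` C).
Proof.
move=> sK [I [g [k [gG kK ->]]]]; exists I, g, (fun i => ~` k i); split=> // i.
move: (kK i); rewrite -(measurable_g_measurableTypeE sK).
exact: measurableC.
Qed.

Lemma piecewiseU G K B C : sigma_algebra setT G -> sigma_algebra setT K ->
  piecewise G K B -> piecewise G K C -> piecewise G K (B `|` C).
Proof.
move=> sG sK [I [g [k [gG kK ->]]]] [J [h [l [hG lK ->]]]].
exists (I * J)%type, (fun w => (g w, h w)), (fun ij => k ij.1 `|` l ij.2).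
split=> //; first exact: finite_selector_pair.
move=> [i j]; move: (kK i) (lK j).
rewrite -(measurable_g_measurableTypeE sK).
exact: measurableU.
Qed.

(** The set splits along the finitely many labels into rectangles with one side in [G] and the other
    in [K]. *)
Lemma piecewise_sigma_join G K C : piecewise G K C -> sigma_join G K C.
Proof.
move=> [I [g [k [gG kK ->]]]].
have -> : [set w | k (g w) w] = \bigcup_(i in [set: I]) (g @^-1` [set i] `&` k i).
  by apply/seteqP; split=> [w kw|w [i _ /= [-> ]]//]; exists (g w).
apply: (@fin_bigcup_measurable _ (g_sigma_algebraType (G `|` K))) => //.
by move=> i _; apply: (@measurableI _ (g_sigma_algebraType (G `|` K)));
  apply: sub_sigma_algebra; [left|right].
Qed.

End piecewise_sets.

(** * Approximation of events of the join up to small probability *)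

Section approximation.
Context (R : realType) (d : measure_display) (Omega : measurableType d).
Context (P : probability Omega R).
Implicit Types (G K : set (set Omega)) (B C D : set Omega) (e : R).

Definition small e D := measurable D /\ (P D <= e%:E)%E.

Lemma smallU e D D' : small (e / 2) D -> small (e / 2) D' -> small e (D `|` D').
Proof.
move=> [mD PD] [mD' PD']; split; first exact: measurableU.
by rewrite (le_trans (measureU2 _ mD mD'))// [e]splitr EFinD leeD.
Qed.

(** The exceptional set [D] only has to contain the symmetric difference of [B] and [C], so errors
    combine by taking unions. *)
Definition equal_off D B C := forall w, ~ D w -> (B w <-> C w).

Definition approximable G K B := forall e, 0 < e ->
  exists C D, [/\ piecewise G K C, small e D & equal_off D B C].

Lemma approximable_piecewise G K C : piecewise G K C -> approximable G K C.
Proof.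
move=> pC e e0; exists C, set0; split=> //.
by split=> //; rewrite measure0 lee_fin ltW.
Qed.

Lemma approximableC G K B : sigma_algebra setT K ->
  approximable G K B -> approximable G K (~` B).
Proof.
move=> sK aB e /aB[C [D [pC sD BC]]]; exists (~` C), D.
by split=> //; [exact: piecewiseC | move=> w /BC /= ->].
Qed.

Lemma approximableU G K B B' : sigma_algebra setT G -> sigma_algebra setT K ->
  approximable G K B -> approximable G K B' -> approximable G K (B `|` B').
Proof.
move=> sG sK aB aB' e e0; have e20 : 0 < e / 2 by rewrite divr_gt0.
have [C [D [pC sD BC]]] := aB _ e20.
have [C' [D' [pC' sD' BC']]] := aB' _ e20.
exists (C `|` C'), (D `|` D'); split; [exact: piecewiseU | exact: smallU |].
by move=> w /not_orP[/BC + /BC'] /= => -> ->.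
Qed.

(** The remainders [V n] left by the finite unions [U n] decrease to the empty set, so continuity
    from above reduces the claim to a finite union. *)
Lemma approximable_bigcup G K (B : (set Omega)^nat) :
  sigma_algebra setT G -> sigma_algebra setT K ->
  (forall n, measurable (B n)) -> (forall n, approximable G K (B n)) ->
  approximable G K (\bigcup_n B n).
Proof.
move=> sG sK mB aB e e0; have e20 : 0 < e / 2 by rewrite divr_gt0.
pose U n := \big[setU/set0]_(i < n) B i.
have aU n : approximable G K (U n).
  rewrite /U; elim: n => [|n IHn].
    rewrite big_ord0; apply/approximable_piecewise/piecewise_right => //.
    by case: sK.
  by rewrite big_ord_recr /=; exact: approximableU.
have mU n : measurable (U n) by exact: bigsetU_measurable.
have mUB : measurable (\bigcup_n B n) by exact: bigcup_measurable.
pose V n := (\bigcup_n B n) `\` U n.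
have mV n : measurable (V n) by exact: measurableD.
have V0 : \bigcap_n V n = set0.
  apply/seteqP; split=> // w Vw; have [[n _ Bnw] _] := Vw 0%N I.
  have [_] := Vw n.+1 I; apply; rewrite /U -bigcup_mkord.
  by exists n => //=.
have cV : P (V n) @[n --> \oo] --> 0%E.
  have -> : 0%E = P (\bigcap_n V n) by rewrite V0 measure0.
  apply: nonincreasing_cvg_mu => //.
  - by rewrite (le_lt_trans (probability_le1 _ _)) ?ltry.
  - by rewrite V0.
  move=> m n mn; apply/subsetPset => w [Bw nU]; split=> // Uw; apply: nU.
  exact: (subset_bigsetU mn).
(* Half of the error budget pays for the remainder [V N], the other half for approximating [U N]. *)
have [_ /cvgrPdist_lt /(_ _ e20) [N _ /(_ N (leqnn _))]] := (fine_cvgP _ _).1 cV.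
rewrite /= sub0r normrN ger0_norm ?fine_ge0// => PVN.
have [C [D [pC sD UC]]] := aU N _ e20.
have sV : small (e / 2) (V N).
  by split=> //; rewrite -(fineK (fin_num_measure P _ (mV N))) lee_fin ltW.
exists C, (V N `|` D); split=> //; first exact: smallU.
move=> w /not_orP[nV /UC <-]; split=> [Bw|].
  by apply: contrapT => nU; apply: nV.
by rewrite /U -bigcup_mkord => -[n _ Bn]; exists n.
Qed.

(** The measurable approximable sets form a sigma-algebra containing [G] and [K]. Measurability is
    carried along because the countable union step relies on continuity of [P]. *)
Lemma approximable_sigma_join G K B : sub_sigma_field G -> sub_sigma_field K ->
  sigma_join G K B -> measurable B /\ approximable G K B.
Proof.
move=> [sG mG] [sK mK].
move: B; apply: (@smallest_sub _ _ _ [set B | measurable B /\ approximable G K B]).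
  split=> /=.
  - split=> //; apply/approximable_piecewise/piecewise_right => //.
    by case: sK.
  - by move=> A [mA aA]; rewrite setTD; split; [exact: measurableC | exact: approximableC].
  - move=> A mA; split; first by apply: bigcup_measurable => n _; case: (mA n).
    by apply: approximable_bigcup => // n; case: (mA n).
move=> A [GA|KA]; split; [exact: mG| |exact: mK|];
  apply: approximable_piecewise; [exact: piecewise_left|exact: piecewise_right].
Qed.

(** By induction on [n]: the label for the new event is paired with the common label of the earlier
    ones, each side receiving half of the error. *)
Lemma approximable_family G (K : nat -> set (set Omega)) (B : nat -> set Omega) n :
  sub_sigma_field G -> (forall j, (j < n)%N -> sub_sigma_field (K j)) ->
  (forall j, (j < n)%N -> sigma_join G (K j) (B j)) -> forall e, 0 < e ->
  exists (I : finType) (g : Omega -> I) (k : nat -> I -> set Omega) D,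
    [/\ finite_selector G g, forall j i, (j < n)%N -> K j (k j i), small e D &
        forall j, (j < n)%N -> equal_off D (B j) [set w | k j (g w) w]].
Proof.
move=> sG; elim: n => [|n IHn] sK BK e e0.
  exists unit, (fun=> tt), (fun _ _ => set0), set0; split=> //; last first.
    by split=> //; rewrite measure0 lee_fin ltW.
  move=> -[]; case: sG => sG _.
  rewrite -(measurable_g_measurableTypeE sG) (_ : _ @^-1` _ = setT) //.
  by apply/seteqP; split.
have e20 : 0 < e / 2 by rewrite divr_gt0.
have [||I [g [k [D [gG kK sD BD]]]]] := IHn _ _ _ e20.
- by move=> j jn; apply: sK; exact: ltnW.
- by move=> j jn; apply: BK; exact: ltnW.
have [_ aB] := approximable_sigma_join sG (sK _ (ltnSn n)) (BK _ (ltnSn n)).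
have [_ [D' [[I' [g' [k' [gG' kK' ->]]]] sD' BD']]] := aB _ e20.
(* The new event reads the second coordinate of the label, the earlier ones read the first. *)
exists (I * I')%type, (fun w => (g w, g' w)),
  (fun j ii => if j == n then k' ii.2 else k j ii.1), (D `|` D').
split.
- by apply: finite_selector_pair => //; case: sG.
- move=> j [i i'] /=; rewrite ltnS leq_eqVlt; case: eqP => [-> _//|_ /=].
  exact: kK.
- exact: smallU.
- move=> j; rewrite ltnS leq_eqVlt => jn w /not_orP[nD nD'] /=.
  case: eqP jn => [-> _|_ /= jn]; [exact: BD'|exact: BD].
Qed.

End approximation.

(** * First entry times on a finite grid *)

Section first_entry.
Context (Omega : Type) (m : nat).
Implicit Type k : nat -> set Omega.

(** If [w] lies in none of [k 0], ..., [k (m - 1)], [find] returns [m], the index that stands for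
    the terminal time [T]. *)
Definition first_entry k w := find (fun j => `[< k j w >]) (iota 0 m).

Lemma first_entry_le k w : (first_entry k w <= m)%N.
Proof. by rewrite -[X in (_ <= X)%N](size_iota 0 m) find_size. Qed.

Lemma first_entryP k w : (first_entry k w < m)%N -> k (first_entry k w) w.
Proof.
move=> hm; have := hm; rewrite -[X in (_ < X)%N](size_iota 0 m) -has_find => /(nth_find 0%N).
by rewrite nth_iota// add0n => /asboolP.
Qed.

Lemma first_entry_min k w j : (j < m)%N -> k j w -> (first_entry k w <= j)%N.
Proof.
move=> jm kj; rewrite leqNgt; apply/negP => /(before_find 0%N).
by rewrite nth_iota// add0n => /asboolP.
Qed.

Lemma before_first_entry k w j : (j < first_entry k w)%N -> ~ k j w.
Proof.
move=> jf kj; have := leq_trans jf (first_entry_le k w) => jm.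
by have := leq_trans jf (first_entry_min jm kj); rewrite ltnn.
Qed.

End first_entry.

(** For [u < T], the time is at most [u] exactly on the union of the [k j] with [j < m] and
    [s j <= u], and each such [k j] lies in [H (s j)], hence in [H u]. For [u >= T] the event is the
    whole space. *)
Lemma stopping_time_first_entry (R : realType) (d : measure_display)
    (Omega : measurableType d) (t T : R) (H : R -> set (set Omega)) (m : nat)
    (s : nat -> R) (k : nat -> set Omega) :
  filtration t T H -> {homo s : i j / (i <= j)%N >-> i <= j} ->
  t <= s 0%N -> s m = T -> (forall j, (j < m)%N -> H (s j) (k j)) ->
  stopping_time t T H (fun w => s (first_entry m k w)).
Proof.
move=> [sH HH] s_nd ts sT kH.
have ts_ j : t <= s j by rewrite (le_trans ts)// s_nd.
split=> [w|u tu]; first by rewrite ts_ -sT s_nd// first_entry_le.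
have /andP[tu' uT] := tu.
have [sHu _] := sH u tu.
rewrite -(measurable_g_measurableTypeE sHu).
have [Tu|uT'] := leP T u.
  rewrite (_ : [set w | _] = setT)//; apply/seteqP; split=> // w _ /=.
  by rewrite (le_trans _ Tu)// -sT s_nd// first_entry_le.
have -> : [set w | s (first_entry m k w) <= u] =
    \bigcup_(j in [set j | (j < m)%N /\ s j <= u]) k j.
  apply/seteqP; split=> [w /= su|w [j [jm sju] kj]] /=; last first.
    by rewrite (le_trans _ sju)// s_nd// first_entry_min.
  (* The default index [m] is excluded, since [s m = T > u]. *)
  have fm : (first_entry m k w < m)%N.
    rewrite ltn_neqAle first_entry_le andbT; apply/eqP => fm.
    by move: su; rewrite fm sT leNgt uT'.
  by exists (first_entry m k w) => //; exact: first_entryP.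
apply: bigcup_measurable => j [jm sju].
have := kH j jm; have := HH _ _ (ts_ j) sju uT.
rewrite -[X in _ `<=` X](measurable_g_measurableTypeE sHu); exact.
Qed.

(** The selected grid point is the first one at or above [x]; its predecessor lies below [x], so the
    distance is at most the mesh. *)
Lemma first_entry_dist (R : realType) (Omega : Type) (t T e x : R) (m : nat)
    (s : nat -> R) (k : nat -> set Omega) w :
  t <= x <= T -> s 0%N = t -> s m = T -> (forall j, s j.+1 - s j <= e) ->
  0 <= e -> (forall j, (j < m)%N -> (x <= s j <-> k j w)) ->
  `|s (first_entry m k w) - x| <= e.
Proof.
move=> /andP[tx xT] s0 sm se e0 xk.
have x_le : x <= s (first_entry m k w).
  have := first_entry_le m k w; rewrite leq_eqVlt => /orP[/eqP->|fm].
    by rewrite sm.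
  by apply/xk => //; exact: first_entryP.
rewrite ger0_norm ?subr_ge0// lerBlDr.
(* Index 0 has no predecessor, but there [s 0 = t <= x] already suffices. *)
case fE : (first_entry m k w) => [|j]; first by rewrite s0 (le_trans tx)// lerDr.
have jf : (j < first_entry m k w)%N by rewrite fE.
have jm : (j < m)%N by rewrite (leq_trans jf)// first_entry_le.
have /ltW sx : s j < x.
  by rewrite ltNge; apply/negP => /(xk _ jm).1; exact: before_first_entry jf.
by have := se j; rewrite lerBlDr => /le_trans; apply; rewrite lerD2l.
Qed.

(* Cells that are empty must be discarded, as [partition] requires its members
   to be nonempty. *)
Lemma finite_selector_sum (R : realType) (T : Type) (G : set (set T))
    (I : finType) (g : T -> I) (sigma : I -> T -> R) :
  finite_selector G g ->
  exists N (idx : 'I_N -> I) (A : 'I_N -> set T),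
    [/\ forall i, G (A i), partition setT A setT &
        forall w, sigma (g w) w = \sum_(i < N) sigma (idx i) w * \1_(A i) w].
Proof.
move=> gG; pose J := {i : I | `[< g @^-1` [set i] !=set0 >]}.
pose idx (i : 'I_#|{: J}|) : I := val (enum_val i).
have gJ w : `[< g @^-1` [set g w] !=set0 >] by apply/asboolP; exists w.
pose r w : 'I_#|{: J}| := enum_rank (Sub (g w) (gJ w)).
have idxr w : idx (r w) = g w by rewrite /idx enum_rankK.
have idx_inj : injective idx by move=> i j /val_inj /enum_val_inj.
exists #|{: J}|, idx, (fun i => g @^-1` [set idx i]); split=> //.
  split.
  - by apply/seteqP; split=> // w _; exists (r w) => //=.
  - by move=> i j _ _ [w /= [-> /idx_inj]].
  - by move=> i _; have /asboolP := valP (enum_val i).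
move=> w; rewrite (bigD1 (r w))//= idxr big1 ?addr0.
  by rewrite indicE mem_set ?mulr1.
move=> i ir; rewrite indicE memNset ?mulr0//= => gi.
by move/eqP: ir; apply; apply: idx_inj; rewrite idxr.
Qed.

(** * Approximating stopping times and almost sure convergence *)

(** The grid is uniform with [n.+1] steps. Only the events at grid times of index below [n.+1] are
    approximated, because the last time [T] is the default of [first_entry]. *)
Lemma stopping_time_approx (R : realType) (d : measure_display)
    (Omega : measurableType d) (P : probability Omega R) (T t : R)
    (H F : R -> set (set Omega)) (G : set (set Omega)) (tau : Omega -> R)
    (e : R) (n : nat) :
  filtration t T H -> sub_sigma_field G ->
  (forall s, t <= s <= T -> F s = sigma_join G (H s)) ->
  stopping_time t T F tau -> 0 < e ->
  exists (I : finType) (g : Omega -> I) (sigma : I -> Omega -> R) D,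
    [/\ finite_selector G g, forall i, stopping_time t T H (sigma i), small P e D &
        forall w, ~ D w -> `|sigma (g w) w - tau w| <= (T - t) / n.+1%:R].
Proof.
move=> Hfilt Gs FE [tauT tauF] e0; have [Hs _] := Hfilt.
(* A measurable type is pointed, and the value of [tau] at [point] lies between [t] and [T]. *)
have tT : t <= T by have /andP[] := tauT point; exact: le_trans.
pose step : R := (T - t) / n.+1%:R.
pose s (j : nat) : R := t + step * j%:R.
have step0 : 0 <= step by rewrite divr_ge0// subr_ge0.
have s_0 : s 0%N = t by rewrite /s mulr0 addr0.
have s_T : s n.+1 = T by rewrite /s /step divfK// addrC subrK.
have s_step j : s j.+1 - s j <= step.
  by rewrite /s opprD addrACA subrr add0r -mulrBr -natrB// subSnn mulr1.
have s_nd : {homo s : i j / (i <= j)%N >-> i <= j}.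
  by move=> i j ij; rewrite lerD2l ler_wpM2l// ler_nat.
have s_in j : (j < n.+1)%N -> t <= s j <= T.
  by move=> jn; rewrite -s_0 -s_T !s_nd// ltnW.
have [||I [g [k [D [gG kH sD Dk]]]]] := @approximable_family _ _ _ P G
    (fun j => H (s j)) (fun j => [set w | tau w <= s j]) n.+1 Gs _ _ _ e0.
- by move=> j /s_in; exact: Hs.
- by move=> j /s_in sj; rewrite -FE//; exact: tauF.
exists I, g, (fun i w => s (first_entry n.+1 (k ^~ i) w)), D; split=> //.
  move=> i; apply: stopping_time_first_entry => //; first by rewrite s_0.
  by move=> j jn; exact: kH.
move=> w nD; apply: (first_entry_dist (tauT w)) => // j jn.
exact: (Dk _ jn _ nD).
Qed.

(** Each event that the pasted time is at most [s] is piecewise over the labels of [g], with pieces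
    in [H s]. *)
Lemma stopping_time_paste (R : realType) (Omega : pointedType) (t T : R)
    (H F : R -> set (set Omega)) (G : set (set Omega)) (I : finType)
    (g : Omega -> I) (sigma : I -> Omega -> R) :
  (forall s, t <= s <= T -> F s = sigma_join G (H s)) ->
  finite_selector G g -> (forall i, stopping_time t T H (sigma i)) ->
  stopping_time t T F (fun w => sigma (g w) w).
Proof.
move=> FE gG sH; split=> [w|s ts]; first by case: (sH (g w)).
rewrite FE//; apply: piecewise_sigma_join.
exists I, g, (fun i => [set w | sigma i w <= s]); split=> // i.
by case: (sH i) => _; exact.
Qed.

(** Borel-Cantelli: the limit superior of the [D n] is null, and a point outside it avoids [D n] for
    all large [n], where the bound [delta / n.+1%:R] forces convergence. *)
Lemma ae_cvg_small (R : realType) (d : measure_display)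
    (Omega : measurableType d) (P : probability Omega R)
    (f : nat -> Omega -> R) (h : Omega -> R) (D : nat -> set Omega)
    (delta : R) :
  (forall n, small P (1 / (2 ^ n.+1)%:R) (D n)) ->
  (forall n w, ~ D n w -> `|f n w - h w| <= delta / n.+1%:R) ->
  {ae P, forall w, f n w @[n --> \oo] --> h w}.
Proof.
move=> sD fh; have mD n : measurable (D n) by case: (sD n).
exists (lim_sup_set D); split.
- by apply: bigcap_measurable => // n _; exact: bigcup_measurable.
- apply: lim_sup_set_cvg0 => //.
  (* The bounds [1 / 2 ^ n.+1] sum to at most 1. *)
  apply: (@le_lt_trans _ _ 1%:E); last exact: ltry.
  apply: (le_trans _ (epsilon_trick0 xpredT ler01)).
  by apply: lee_nneseries => // n _; case: (sD n).
move=> w; apply: contra_notP => /existsNP[N /not_implyP[_ nDw]].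
have cvg0 : delta / n.+1%:R @[n --> \oo] --> 0.
  by rewrite -(mulr0 delta); apply: cvgMr; exact: cvg_harmonic.
apply/cvgrPdist_le => eps eps0; near=> n.
rewrite distrC (le_trans (fh n w _))//.
  by move=> Dn; apply: nDw; exists n => //=; near: n; exact: nbhs_infty_ge.
apply: le_trans (ler_norm _) _; rewrite -normrN -sub0r; near: n.
by have /cvgrPdist_le := cvg0; apply.
Unshelve. all: by end_near. Qed.

Theorem theorem3p1 (R : realType) (d : measure_display)
    (Omega : measurableType d) (P : probability Omega R)
    (Pcomplete : measure_is_complete P)
    (T t : R) (T_gt0 : 0 < T) (t_in : 0 <= t <= T)
    (H : R -> set (set Omega)) (G : set (set Omega))
    (Hfilt : filtration t T H) (Gsigma : sub_sigma_field G)
    (GH_indep : independent_sigma_fields P G (H T))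
    (F : R -> set (set Omega))
    (FE : forall s, t <= s <= T -> F s = sigma_join G (H s))
    (tau : Omega -> R) (tau_st : stopping_time t T F tau) :
  exists (N : nat -> nat) (tau_ : nat -> Omega -> R),
    [/\ forall n, stopping_time t T F (tau_ n),
        {ae P, forall w, tau_ n w @[n --> \oo] --> tau w} &
        forall n, exists (sigma : 'I_(N n) -> Omega -> R)
                         (A : 'I_(N n) -> set Omega),
          [/\ forall i, stopping_time t T H (sigma i),
              forall i, G (A i),
              partition setT A setT &
              forall w, tau_ n w = \sum_(i < N n) sigma i w * \1_(A i) w]].
Proof.
have e0 n : 0 < 1 / (2 ^ n.+1)%:R :> R by rewrite divr_gt0// ltr0n expn_gt0.
(* The time and its exceptional set are bundled in a pair, so that a single use of choice yields
   both sequences. *)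
have approx n : exists tauD : (Omega -> R) * set Omega,
    [/\ stopping_time t T F tauD.1, small P (1 / (2 ^ n.+1)%:R) tauD.2,
        forall w, ~ tauD.2 w -> `|tauD.1 w - tau w| <= (T - t) / n.+1%:R &
        exists N (sigma : 'I_N -> Omega -> R) (A : 'I_N -> set Omega),
          [/\ forall i, stopping_time t T H (sigma i), forall i, G (A i),
              partition setT A setT &
              forall w, tauD.1 w = \sum_(i < N) sigma i w * \1_(A i) w]].
  have [I [g [sigma [D [gG sH sD Dtau]]]]] :=
    stopping_time_approx P n Hfilt Gsigma FE tau_st (e0 n).
  exists ((fun w => sigma (g w) w), D); split=> //.
    exact: (stopping_time_paste FE gG sH).
  have [N [idx [A [AG Apart sumA]]]] := finite_selector_sum sigma gG.
  by exists N, (fun i => sigma (idx i)), A; split.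
have [tauD tauDP] := choice approx.
(* A second choice extracts the number of cells as a function of [n]. *)
have /choice[N NP] n : exists N (sigma : 'I_N -> Omega -> R) (A : 'I_N -> set Omega),
    [/\ forall i, stopping_time t T H (sigma i), forall i, G (A i),
        partition setT A setT &
        forall w, (tauD n).1 w = \sum_(i < N) sigma i w * \1_(A i) w].
  by case: (tauDP n).
exists N, (fun n => (tauD n).1); split=> //; first by move=> n; case: (tauDP n).
by apply: (@ae_cvg_small _ _ _ _ _ _ (fun n => (tauD n).2) (T - t)) => n;
  case: (tauDP n).
Qed.
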